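(* Let $F:\mathbb{R}^N\to[0,+\infty)$ be a $C^1$ strictly convex norm. Let $1<p<N$. For every $\gamma> p-N$ one has \[ \left(\frac{N+\gamma-p}{p}\right)^p\,\int_{\mathbb{R}^N} |v|^p\,F_*(x)^{\gamma-p}\, dx\le \int_{\mathbb{R}^{N}} F(\nabla v)^p\,F_*(x)^{\gamma}\, dx \qquad\text{for every } v\in C^1_0(\mathbb{R}^N\setminus\{0\}), \] where $F_*$ is the dual norm defined by \[ F_*(z)=\sup_{x\not=0} \left\langle\frac{x}{F(x)},z\right\rangle,\qquad z\in\mathbb{R}^N. \]
   Context: ''$C^1$ strictly convex norm'' means that $F$ is a norm on $\mathbb{R}^N$ which is of class $C^1$ on $\mathbb{R}^N\setminus\{0\}$ and whose closed unit ball is strictly convex. $C^1_0(\mathbb{R}^N\setminus\{0\})$ is the space of real-valued $C^1$ functions with compact support contained in $\mathbb{R}^N\setminus\{0\}$. $\langle\cdot,\cdot\rangle$ is the Euclidean scalar product. *)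

(* Defs.v *)
From HB Require Import structures.
From mathcomp Require Import all_boot all_order all_algebra.
From mathcomp Require Import all_classical all_reals all_analysis.
From mathcomp Require Import measurable_realfun.

Set Implicit Arguments.
Unset Strict Implicit.
Unset Printing Implicit Defensive.

Import Order.TTheory GRing.Theory Num.Theory.
Import numFieldNormedType.Exports.

Local Open Scope classical_set_scope.
Local Open Scope ring_scope.

(* R^N is 'rV[R]_N with its product topology; the norm that the library puts on
   it is the sup norm, which only matters through the topology it induces. *)

Section EuclideanCalculus.
Context {R : realType} {N : nat}.
Implicit Types (x y z : 'rV[R]_N) (f F : 'rV[R]_N -> R) (U A : set 'rV[R]_N).

Definition dotprod x y : R := \sum_(i < N) x ord0 i * y ord0 i.

Definition grad f x : 'rV[R]_N := \row_(i < N) 'D_(delta_mx ord0 i) f x.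

(* For U open. *)
Definition C1_on U f : Prop :=
  (forall x, U x -> differentiable f x) /\
  (forall x, U x -> {for x, continuous (grad f)}).

Definition support_of f : set 'rV[R]_N := closure [set x | f x != 0].

(* C^1_0(R^N \ {0}); such a function is identified with its extension by 0 to
   the origin: the last condition forces f to vanish near 0. *)
Definition C1_0_punctured f : Prop :=
  [/\ C1_on [set~ 0] f, compact (support_of f) & support_of f `<=` [set~ 0]].

Record is_norm F : Prop := IsNorm {
  norm_nonneg : forall x, 0 <= F x;
  norm_definite : forall x, F x = 0 -> x = 0;
  norm_homogeneous : forall (a : R) x, F (a *: x) = `|a| * F x;
  norm_triangle : forall x y, F (x + y) <= F x + F y
}.

Definition strictly_convex_set A : Prop :=
  forall x y (t : R), A x -> A y -> x != y -> 0 < t < 1 ->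
    A° (t *: x + (1 - t) *: y).

Definition C1_strictly_convex_norm F : Prop :=
  [/\ is_norm F, C1_on [set~ 0] F & strictly_convex_set [set x | F x <= 1]].

(* [sup] is real-valued; when F is a norm on R^N with N > 0, the set is nonempty
   and bounded above, so that this is a genuine supremum. *)
Definition dual_norm F z : R :=
  sup [set dotprod ((F x)^-1 *: x) z | x in [set x | x != 0]].

End EuclideanCalculus.

(* N-dimensional Lebesgue measure, on the product sigma-algebra (equivalently,
   the Borel sigma-algebra) of N-tuples of reals: the N-fold product of the
   one-dimensional Lebesgue measure. *)
Section LebesgueMeasureRN.
Context {R : realType}.
Local Notation mR := (measurableTypeR R).

Definition cons_pair n (u : mR * n.-tuple mR) : n.+1.-tuple mR :=
  [the n.+1.-tuple mR of u.1 :: u.2].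

Fixpoint lebesgueN (n : nat) : set (n.-tuple mR) -> \bar R :=
  match n with
  | 0 => dirac [tuple]
  | n'.+1 => pushforward (lebesgue_measure \x @lebesgueN n')%E (@cons_pair n')
  end.

Lemma measurable_cons_pair n : measurable_fun setT (@cons_pair n).
Proof. exact: measurable_cons. Qed.

Definition uncons_tuple n (t : n.+1.-tuple mR) : mR * n.-tuple mR :=
  (thead t, [tuple of behead t]).

Lemma cons_pairK n : cancel (@cons_pair n) (@uncons_tuple n).
Proof. by case=> x t; congr pair; apply: val_inj. Qed.

Lemma uncons_tupleK n : cancel (@uncons_tuple n) (@cons_pair n).
Proof. by move=> t; rewrite [RHS]tuple_eta; apply: val_inj. Qed.

Lemma measurable_uncons_tuple n : measurable_fun setT (@uncons_tuple n).
Proof.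
apply/measurable_fun_pairP; split.
  exact: (@measurable_tnth _ mR n.+1 ord0).
exact: measurable_behead.
Qed.

Section cons_measure.
Variables (n : nat) (mu : {sigma_finite_measure set (n.-tuple mR) -> \bar R}).

Definition cons_measure : set (n.+1.-tuple mR) -> \bar R :=
  pushforward (lebesgue_measure \x mu)%E (@cons_pair n).

Let cons_measure0 : cons_measure set0 = 0%E.
Proof. by rewrite /cons_measure /pushforward preimage_set0 measure0. Qed.

Let cons_measure_ge0 A : (0 <= cons_measure A)%E.
Proof. exact: (measure_ge0 [the measure _ _ of (lebesgue_measure \x mu)%E]). Qed.

Let cons_measure_sigma_additive : semi_sigma_additive cons_measure.
Proof.
move=> F mF tF mUF; rewrite /cons_measure /pushforward preimage_bigcup.
apply: measure_semi_sigma_additive.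
- by move=> k; rewrite -[X in measurable X]setTI; exact: measurable_cons_pair.
- apply/trivIsetP => /= i j _ _ ij; rewrite -preimage_setI.
  by move/trivIsetP : tF => /(_ _ _ _ _ ij) ->//; rewrite preimage_set0.
- by rewrite -preimage_bigcup -[X in measurable X]setTI;
    exact: measurable_cons_pair.
Qed.

HB.instance Definition _ := isMeasure.Build _ _ _ cons_measure
  cons_measure0 cons_measure_ge0 cons_measure_sigma_additive.

Let cons_measure_sigma_finite : sigma_finite setT cons_measure.
Proof.
have /sigma_finiteP[F [FT ndF Foo]] := sigma_finiteT (@lebesgue_measure R).
have /sigma_finiteP[G [GT ndG Goo]] := sigma_finiteT mu.
exists (fun k => @uncons_tuple n @^-1` (F k `*` G k)) => [|k].
  rewrite -preimage_bigcup (_ : \bigcup_i _ = setT) ?preimage_setT//.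
  rewrite -setXTT FT GT; apply/seteqP; split => -[x t] /=.
    by move=> [k _ [Fkx Gkt]]; split; exists k.
  move=> [[i _ Fix] [j _ Gjt]]; exists (maxn i j) => //; split.
  - by move: x Fix; exact/subsetPset/ndF/leq_maxl.
  - by move: t Gjt; exact/subsetPset/ndG/leq_maxr.
have [mF Fk] := Foo k; have [mG Gk] := Goo k.
have mFG : measurable (F k `*` G k) by exact: measurableX.
split.
  by rewrite -[X in measurable X]setTI; exact: measurable_uncons_tuple.
rewrite /cons_measure /pushforward (_ : _ @^-1` _ = F k `*` G k); last first.
  by apply/seteqP; split => u; rewrite /preimage /mkset cons_pairK.
by rewrite product_measure1E// lte_mul_pinfty// ge0_fin_numE.
Qed.

HB.instance Definition _ := Measure_isSigmaFinite.Build _ _ _ cons_measure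
  cons_measure_sigma_finite.

Lemma sigma_finite_cons_measure :
  exists mu' : {sigma_finite_measure set (n.+1.-tuple mR) -> \bar R},
    pushforward (lebesgue_measure \x mu)%E (@cons_pair n) = mu'.
Proof. by exists cons_measure. Qed.

End cons_measure.

Lemma lebesgueN_measureE n :
  exists mu : {sigma_finite_measure set (n.-tuple mR) -> \bar R},
    @lebesgueN n = mu.
Proof.
elim: n => [|n [mu muE]] /=; last by rewrite muE; exact: sigma_finite_cons_measure.
by exists (dirac ([tuple] : 0.-tuple mR)).
Qed.

Section lebesgueN_measure.
Variable n : nat.

Let lebesgueN0 : @lebesgueN n set0 = 0%E.
Proof. by have [mu ->] := lebesgueN_measureE n; exact: measure0. Qed.

Let lebesgueN_ge0 A : (0 <= @lebesgueN n A)%E.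
Proof. by have [mu ->] := lebesgueN_measureE n; exact: measure_ge0. Qed.

Let lebesgueN_sigma_additive : semi_sigma_additive (@lebesgueN n).
Proof.
by have [mu ->] := lebesgueN_measureE n; exact: measure_semi_sigma_additive.
Qed.

HB.instance Definition _ := isMeasure.Build _ _ _ (@lebesgueN n)
  lebesgueN0 lebesgueN_ge0 lebesgueN_sigma_additive.

Let lebesgueN_sigma_finite : sigma_finite setT (@lebesgueN n).
Proof. by have [mu ->] := lebesgueN_measureE n; exact: sigma_finiteT. Qed.

HB.instance Definition _ := Measure_isSigmaFinite.Build _ _ _ (@lebesgueN n)
  lebesgueN_sigma_finite.

End lebesgueN_measure.

Lemma lebesgueN_box n (A : 'I_n -> set mR) : (forall i, measurable (A i)) ->
  lebesgueN [set t : n.-tuple mR | forall i, A i (tnth t i)] =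
  (\prod_(i < n) lebesgue_measure (A i))%E.
Proof.
elim: n A => [|n IHn] A mA.
  rewrite big_ord0 /= /dirac indicE mem_set//=.
  by case.
rewrite big_ord_recl -(IHn (fun i => A (lift ord0 i)))//.
have mB : measurable [set t : n.-tuple mR | forall i, A (lift ord0 i) (tnth t i)].
  rewrite (_ : mkset _ = \bigcap_(i : 'I_n) ((@tnth n mR ^~ i) @^-1` A (lift ord0 i))).
    apply: fin_bigcap_measurable => //= i _.
    by rewrite -[X in measurable X]setTI; exact: measurable_tnth.
  by apply/seteqP; split => t /= At i => [_|]; exact: At.
rewrite -product_measure1E// /= /pushforward; congr (_ _).
apply/seteqP; split => -[x t] /=.
  move=> h; split => [|i]; first exact: (h ord0).
  by have := h (lift ord0 i); rewrite tnthS.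
by move=> [Ax At] i; case: (unliftP ord0 i) => [j|] ->; rewrite ?tnthS.
Qed.

End LebesgueMeasureRN.

Arguments lebesgueN R n : clear implicits.

Definition rV_of_tuple {R : realType} {N : nat}
  (t : N.-tuple (measurableTypeR R)) : 'rV[R]_N := \row_(i < N) tnth t i.

(* Integral over R^N of a function with values in [0, +oo]. *)
Definition integralRN {R : realType} {N : nat} (f : 'rV[R]_N -> \bar R) : \bar R :=
  \int[lebesgueN R N]_t f (rV_of_tuple t).

(* Main.v *)
Require Import Defs.
From mathcomp Require Import all_boot all_order all_algebra.
From mathcomp Require Import all_classical all_reals all_analysis.
From mathcomp Require Import measurable_realfun ring lra.
Import Order.TTheory GRing.Theory Num.Theory.
Import numFieldNormedType.Exports.
Local Open Scope classical_set_scope.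
Local Open Scope ring_scope.

(** Along each ray, v(x) is minus the integral over t > 0 of the derivative
    <grad v(e^t x), e^t x> of t |-> v(e^t x).  With c = (N + gamma - p) / p, a
    one-dimensional weighted inequality bounds c^(p-1) |v(x)|^p by the integral
    over t > 0 of |<grad v(y), y>|^p e^(c(p-1)t) at y = e^t x.  Multiply by
    F_*(x)^(gamma-p), integrate in x and exchange the integrals: by homogeneity
    of F_* and of Lebesgue measure under the dilation x |-> e^t x, the inner
    integral becomes e^(-ct) times a constant, and integrating in t gives the
    factor 1/c.  Finally |<grad v(y), y>| <= F(grad v(y)) F_*(y). *)

(** * A weighted one-dimensional inequality on the half-line *)

(** This is Young's inequality for [y] and [z ^ (p - 1)] with conjugate exponents [p] and
    [p / (p - 1)], multiplied by [p]. Geometrically, the convex graph of the [p]-th power lies above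
    its tangent at [z]. *)
Lemma mul_powR_tangent (R : realType) (p y z : R) : 1 < p -> 0 <= y -> 0 <= z ->
  p * z `^ (p - 1) * y <= y `^ p + (p - 1) * z `^ p.
Proof.
move=> p1 y0 z0; have p0 : 0 < p by lra.
have q0 : 0 < p / (p - 1) by rewrite divr_gt0 //; lra.
have := @conjugate_powR R y (z `^ (p - 1)) p (p / (p - 1)) y0 (powR_ge0 _ _) p0 q0.
rewrite -powRrM mulrCA divff ?mulr1; last lra.
have -> : p^-1 + (p / (p - 1))^-1 = 1 by field; lra.
move=> /(_ erefl) h.
have {h} := ler_wpM2l (ltW p0) h.
have -> : p * (y `^ p / p + z `^ p / (p / (p - 1))) = y `^ p + (p - 1) * z `^ p by field; lra.
by rewrite (mulrC y) mulrA.
Qed.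

(** The integrand [g] dominates a function [k] with explicit primitive [K]. Since [phi T = 0],
    integrating [k] over [[0, T]] leaves a value that depends on [phi] only through [phi 0]. *)
Lemma hardy_halfline (R : realType) (phi dphi : R -> R) (c p T : R) :
  0 < c -> 1 < p -> 0 < T ->
  (forall t : R, is_derive t (1 : R) phi (dphi t)) -> continuous dphi -> phi T = 0 ->
  ((c `^ (p - 1) * `|phi 0| `^ p)%:E <=
   \int[lebesgue_measure]_(t in `[0%R, +oo[)
     (`|dphi t| `^ p * expR (c * (p - 1) * t))%:E)%E.
Proof.
move=> c0 p1 T0 dphiE cdphi phiT.
(* The tangent inequality for y |-> y^p is applied at the point [z], the common
   value of [`|phi'| e^(ct)] in the case of equality [phi t = phi 0 e^(-ct)]. *)
pose z := c * `|phi 0|; pose s := Num.sg (phi 0).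
have z0 : 0 <= z by rewrite mulr_ge0 // ltW.
pose A := p * z `^ (p - 1); pose B := (p - 1) * z `^ p.
have A0 : 0 <= A by rewrite mulr_ge0 ?powR_ge0 //; lra.
have B0 : 0 <= B by rewrite mulr_ge0 ?powR_ge0 //; lra.
(* The tangent inequality bounds [g] below by [A * |dphi| - B * e^(-ct)]. Replacing [|dphi|] by the
   smaller [- s * dphi] makes this bound the exact derivative [k] of [K]. *)
pose K (t : R) := - (A * s) * phi t + B / c * expR (- c * t).
pose k (t : R) := - (A * s) * dphi t - B * expR (- c * t).
pose g t := `|dphi t| `^ p * expR (c * (p - 1) * t).
have dK (t : R) : is_derive t (1 : R) K (k t).
  rewrite /K /k.
  have := dphiE t => ?.
  apply: is_derive_eq.
  rewrite /GRing.scale /=; field; lra.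
have ck : continuous k.
  move=> t; apply: cvgB; apply: cvgM; try exact: cvg_cst; first exact: cdphi.
  apply: continuous_comp; last exact: continuous_expR.
  by apply: cvgM; [exact: cvg_cst|exact: cvg_id].
have mg : measurable_fun setT g.
  apply: measurable_funM.
    apply: (measurableT_comp (measurable_powR p)).
    apply: measurableT_comp => //.
    exact: continuous_measurable_fun.
  by apply: measurableT_comp => //; apply: measurable_funM.
have mk : measurable_fun setT k by exact: continuous_measurable_fun.
have g0 t : 0 <= g t by rewrite mulr_ge0 ?powR_ge0 ?expR_ge0.
have kg t : k t <= g t.
  rewrite /k.
  have := @mul_powR_tangent R p (`|dphi t| * expR (c * t)) z p1 _ z0.
  rewrite mulr_ge0 ?expR_ge0 // => /(_ isT).
  rewrite -/A -/B powRM ?expR_ge0 // -expRM => h.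
  have {h} := ler_wpM2r (expR_ge0 (- c * t)) h.
  have e1 : expR (c * t) * expR (- c * t) = 1.
    by rewrite -expRD mulNr subrr expR0.
  have e2 : expR (c * t * p) * expR (- c * t) = expR (c * (p - 1) * t).
    by rewrite -expRD; congr expR; ring.
  have -> : A * (`|dphi t| * expR (c * t)) * expR (- c * t) = A * `|dphi t|.
    by rewrite -!mulrA e1 mulr1.
  rewrite mulrDl -(mulrA (_ `^ p)) e2 -lerBlDr -/(g t).
  apply: le_trans; rewrite lerB //.
  rewrite mulNr -mulrA -mulrN; apply: ler_wpM2l => //.
  apply: le_trans (ler_norm _) _; rewrite normrN normrM -[leRHS]mul1r.
  by apply: ler_wpM2r => //; rewrite /s normr_sg; case: (phi 0 != 0).
have step1 : (\int[lebesgue_measure]_(t in `[0%R, T]) (k t)%:E <=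
    \int[lebesgue_measure]_(t in `[0%R, +oo[) (g t)%:E)%E.
  apply: (@le_trans _ _ (\int[lebesgue_measure]_(t in `[0%R, T]) (g t)%:E)%E); last first.
    apply: ge0_subset_integral => //.
    - by apply/measurable_EFinP; apply: measurable_funTS.
    - by move=> x _; rewrite lee_fin.
    - by move=> x /=; rewrite !in_itv /= andbT => /andP[].
  (* [k] has no fixed sign, so its integral is first bounded by that of its positive part, which
     stays below [g] because [g] is nonnegative. *)
  rewrite integralE.
  apply: (@le_trans _ _ (\int[lebesgue_measure]_(t in `[0%R, T]) (EFin \o k)^\+ t)%E).
    by rewrite -[leRHS]sube0; apply: leeB => //; exact: integral_ge0.
  apply: ge0_le_integral => //.
  - by apply: measurable_funepos; apply/measurable_EFinP; apply: measurable_funTS.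
  - by apply/measurable_EFinP; apply: measurable_funTS.
  - by move=> x _; rewrite funeposE -EFin_max lee_fin ge_max kg g0.
rewrite -/g; apply: le_trans step1.
rewrite (continuous_FTC2 (F := K)) //.
- rewrite -EFinB lee_fin /K phiT mulr0 add0r mulr0 expR0 mulr1.
  have powS (x : R) : 0 <= x -> x `^ p = x `^ (p - 1) * x.
    move=> x0; rewrite -{3}(powRr1 x0) -powRD ?subrK //.
    by rewrite gt_eqF //; lra.
  (* With this [Q], the difference [K T - K 0] equals [p Q - (p - 1) Q + (p - 1) Q e^(-cT)], which
     is at least [Q]. *)
  pose Q := c `^ (p - 1) * `|phi 0| `^ p.
  have zQ : z `^ p = c * Q.
    by rewrite /z powRM ?(ltW c0) // (powS c (ltW c0)) /Q; ring.
  have BQ : B / c = (p - 1) * Q by rewrite /B zQ; field; lra.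
  have AQ : A * s * phi 0 = p * Q.
    rewrite -mulrA /s -normrEsg /A /z powRM ?(ltW c0) // /Q (powS `|phi 0|) //; ring.
  have Q0 : 0 <= Q by rewrite mulr_ge0 ?powR_ge0.
  rewrite -/Q (mulNr (A * s)) AQ BQ.
  have : 0 <= (p - 1) * Q * expR (- c * T) by rewrite mulr_ge0 ?expR_ge0 // mulr_ge0 //; lra.
  lra.
- by apply: continuous_subspaceT.
- split.
  + by move=> x _.
  + by apply: cvg_at_right_filter; apply: differentiable_continuous; apply/derivable1_diffP.
  + by apply: cvg_at_left_filter; apply: differentiable_continuous; apply/derivable1_diffP.
- by move=> x _; rewrite derive1E derive_val.
Qed.

(** * Lebesgue measure under dilations *)

Lemma measurable_mull (R : realType) (a : R) :
  measurable_fun [set: measurableTypeR R] (fun x : measurableTypeR R => a * x : measurableTypeR R).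
Proof. exact: measurable_funM. Qed.

(** By uniqueness of Lebesgue measure: [a] times its image under [x |-> a x] gives every interval
    []x, y]] its length. *)
Lemma ge0_integral_lebesgue_scale (R : realType) (a : R)
    (f : measurableTypeR R -> \bar R) :
  0 < a -> measurable_fun setT f -> (forall x, 0 <= f x)%E ->
  (\int[lebesgue_measure]_x f (a * x)%R =
   (a^-1)%:E * \int[lebesgue_measure]_x f x)%E.
Proof.
move=> a0 mf f0.
pose s (x : measurableTypeR R) : measurableTypeR R := a * x.
have ms : measurable_fun setT s by exact: measurable_mull.
have [pf pfE] : exists pf : {measure set measurableTypeR R -> \bar R},
    pushforward lebesgue_measure s = pf.
  by unshelve eexists; [refine (pushforward (@lebesgue_measure R) s)|].
pose nu := mscale (NngNum (ltW a0)) pf.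
have nuE (A : set (measurableTypeR R)) : measurable A -> A `<=` setT ->
    lebesgue_measure A = nu A.
  move=> mA _; apply: lebesgue_measure_unique => // X /ocitvP[->|[[x y] /= xy ->]].
    by rewrite !measure0.
  rewrite /nu /mscale -pfE /pushforward /=.
  rewrite (_ : s @^-1` _ = `]x / a, y / a]%classic); last first.
    apply/seteqP; split => t; rewrite /s /= !in_itv /=;
      by rewrite ltr_pdivrMr // ler_pdivlMr // (mulrC t).
  rewrite !lebesgue_measure_itv /= !lte_fin ltr_pM2r ?invr_gt0 // xy.
  by rewrite -!EFinB -EFinM; congr EFin; field; lra.
have -> : (\int[lebesgue_measure]_x f x = \int[nu]_x f x)%E.
  by apply: eq_measure_integral => A mA _; apply: nuE.
rewrite ge0_integral_mscale //= -pfE ge0_integral_pushforward //=.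
by rewrite muleA -EFinM mulVf ?gt_eqF // mul1e preimage_setT.
Qed.

(** The measure is a pushforward of a product, so a change of variables and Tonelli split off the
    first coordinate. *)
Lemma ge0_integral_lebesgueNS (R : realType) (n : nat)
    (f : n.+1.-tuple (measurableTypeR R) -> \bar R) :
  measurable_fun setT f -> (forall t, 0 <= f t)%E ->
  (\int[lebesgueN R n.+1]_t f t =
   \int[lebesgue_measure]_x \int[lebesgueN R n]_t f (cons_pair (x, t)))%E.
Proof.
move=> mf f0.
have mc := @measurable_cons_pair R n.
transitivity (\int[lebesgue_measure \x lebesgueN R n]_z f (cons_pair z))%E.
  have := ge0_integral_pushforward mc (lebesgue_measure \x lebesgueN R n)%E measurableT mf.
  by rewrite preimage_setT; apply.
rewrite fubini_tonelli1 //.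
exact: measurableT_comp.
Qed.

Definition scale_tuple {R : realType} {n : nat} (a : R) (t : n.-tuple (measurableTypeR R)) :
  n.-tuple (measurableTypeR R) := [tuple of map (fun x => a * x) t].

Lemma measurable_scale_tuple (R : realType) n (a : R) :
  measurable_fun setT (@scale_tuple R n a).
Proof.
apply/measurable_fun_tnthP => i.
rewrite (_ : _ \o _ = (fun x => a * x) \o (fun t => tnth t i)); last first.
  by apply/funext => t /=; rewrite tnth_map.
apply: measurableT_comp; [exact: measurable_mull|exact: measurable_tnth].
Qed.

(** Induction on the dimension: each coordinate contributes one factor [a^-1] through the
    one-dimensional case. *)
Lemma ge0_integral_lebesgueN_scale (R : realType) (n : nat) (a : R)
    (f : n.-tuple (measurableTypeR R) -> \bar R) :
  0 < a -> measurable_fun setT f -> (forall t, 0 <= f t)%E ->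
  (\int[lebesgueN R n]_t f (scale_tuple a t) =
   ((a ^- n)%:E * \int[lebesgueN R n]_t f t))%E.
Proof.
move=> a0; elim: n f => [|n IHn] f mf f0.
  rewrite expr0 invr1 mul1e; apply: eq_integral => t _.
  by congr f; rewrite (tuple0 t) [LHS]tuple0.
have mfs : measurable_fun setT (fun t => f (scale_tuple a t)).
  by apply: measurableT_comp => //; exact: measurable_scale_tuple.
have mc := @measurable_cons_pair R n.
have mfx x : measurable_fun setT (fun t => f (cons_pair (x, t))).
  apply: measurableT_comp => //.
  by apply: (measurableT_comp mc).
rewrite !ge0_integral_lebesgueNS //.
pose g x := (\int[lebesgueN R n]_t f (cons_pair (x, t)))%E.
have mg : measurable_fun setT g.
  apply: (@measurable_fun_fubini_tonelli_F _ _ _ _ R (lebesgueN R n) (f \o @cons_pair R n)).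
    exact: measurableT_comp.
  by move=> z /=.
(* The induction hypothesis rescales the last [n] coordinates for fixed [x]; the first one is then
   rescaled in [g]. *)
transitivity (\int[lebesgue_measure]_x ((a ^- n)%:E * g (a * x)%R))%E.
  apply: eq_integral => x _; rewrite -IHn //.
  by apply: eq_integral => t _; congr f; apply: val_inj.
rewrite ge0_integralZl //; last 3 first.
- by apply: measurableT_comp => //; exact: measurable_mull.
- by move=> x _; apply: integral_ge0.
- by rewrite lee_fin invr_ge0 exprn_ge0 // ltW.
rewrite ge0_integral_lebesgue_scale //; last by move=> x; apply: integral_ge0.
by rewrite muleA -EFinM exprS invfM mulrC.
Qed.

(** * Integration over all dilations by [e^t], [t >= 0] *)

(** The integrand is [c^-1] times the exponential probability density of rate [c]. *)
Lemma integral_expRN_itv0y (R : realType) (c : R) : 0 < c ->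
  (\int[lebesgue_measure]_t (\1_(`[0%R, +oo[%classic : set R) t * expR (- c * t))%:E =
   (c^-1)%:E :> \bar R)%E.
Proof.
move=> c0.
transitivity (\int[lebesgue_measure]_t ((c^-1)%:E * (exponential_pdf c t)%:E))%E.
  apply: eq_integral => t _; rewrite /exponential_pdf patchE indicE.
  case: ifPn => _; last by rewrite mul0r mule0.
  by rewrite mul1r -EFinM mulrA mulVf ?gt_eqF // mul1r.
rewrite ge0_integralZl //.
- by rewrite integral_exponential_pdf // mule1.
- by apply/measurable_EFinP; exact: measurable_exponential_pdf.
- by move=> t _; rewrite lee_fin exponential_pdf_ge0 // ltW.
- by rewrite lee_fin invr_ge0 ltW.
Qed.

Section Dilations.
Context {R : realType} {n : nat}.
Variables (b : R) (W : n.-tuple (measurableTypeR R) -> \bar R).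
Hypotheses (mW : measurable_fun setT W) (W0 : forall t, (0 <= W t)%E).

(** The half-line is encoded by an indicator, so that [h] lives on a full product space and Tonelli
    applies to it. *)
Let k (t : measurableTypeR R) : R := \1_(`[0%R, +oo[%classic : set R) t * expR (b * t).

Let h (z : measurableTypeR R * n.-tuple (measurableTypeR R)) :=
  ((k z.1)%:E * W (scale_tuple (expR z.1) z.2))%E.

Let k0 t : 0 <= k t. Proof. by rewrite mulr_ge0 ?expR_ge0. Qed.

Let h0 z : (0 <= h z)%E. Proof. by rewrite mule_ge0 // lee_fin. Qed.

Let mh : measurable_fun setT h.
Proof.
apply: emeasurable_funM.
  apply/measurable_EFinP; apply: (@measurableT_comp _ _ _ _ _ _ k) => //.
  apply: measurable_funM; first exact: measurable_indic.
  by apply: measurableT_comp => //; apply: measurable_funM.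
apply: measurableT_comp => //.
apply/measurable_fun_tnthP => i.
rewrite (_ : _ \o _ = (fun z => expR z.1 * tnth z.2 i)); last first.
  by apply/funext => t /=; rewrite tnth_map.
apply: measurable_funM; first exact: measurableT_comp.
by apply: (measurableT_comp (measurable_tnth i)).
Qed.

Let integral_hE x :
  (\int[lebesgue_measure]_(t in `[0%R, +oo[)
     ((expR (b * t))%:E * W (scale_tuple (expR t) x)) =
   \int[lebesgue_measure]_t h (t, x))%E.
Proof.
rewrite integral_mkcond; apply: eq_integral => t _.
rewrite patchE /h /k /= indicE; case: ifPn => _; last by rewrite mul0r mul0e.
by rewrite mul1r.
Qed.

Lemma measurable_integral_dilations : measurable_fun setT (fun x =>
  \int[lebesgue_measure]_(t in `[0%R, +oo[)
     ((expR (b * t))%:E * W (scale_tuple (expR t) x)))%E.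
Proof.
rewrite (_ : (fun _ => _) = fubini_G lebesgue_measure h).
  exact: measurable_fun_fubini_tonelli_G.
by apply/funext => x; exact: integral_hE.
Qed.

(** After exchanging the integrals, the dilation by [e^t] produces [e^(-nt)]. Together with the
    weight [e^(bt)] this is [e^(-ct)], whose integral is [c^-1]. *)
Lemma ge0_integral_dilations (c : R) : 0 < c -> b - n%:R = - c ->
  (\int[lebesgueN R n]_x \int[lebesgue_measure]_(t in `[0%R, +oo[)
      ((expR (b * t))%:E * W (scale_tuple (expR t) x)) =
   (c^-1)%:E * \int[lebesgueN R n]_x W x)%E.
Proof.
move=> c0 bnc.
transitivity (\int[lebesgueN R n]_x \int[lebesgue_measure]_t h (t, x))%E.
  by apply: eq_integral => x _; exact: integral_hE.
rewrite -(fubini_tonelli (m1 := lebesgue_measure) (m2 := lebesgueN R n) h mh h0).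
have IW0 : (0 <= \int[lebesgueN R n]_x W x)%E by apply: integral_ge0.
transitivity (\int[lebesgue_measure]_t
    ((\1_(`[0%R, +oo[%classic : set R) t * expR (- c * t))%:E *
     \int[lebesgueN R n]_x W x))%E.
  apply: eq_integral => t _; rewrite /h /=.
  rewrite ge0_integralZl //; last 2 first.
  - by apply: measurableT_comp => //; exact: measurable_scale_tuple.
  - by rewrite lee_fin.
  rewrite ge0_integral_lebesgueN_scale ?expR_gt0 // muleA -EFinM /k -mulrA.
  congr (_ %:E * _)%E; congr (_ * _).
  by rewrite -expRM_natl -expRN -expRD -bnc; congr expR; ring.
rewrite ge0_integralZr // ?integral_expRN_itv0y //.
apply/measurable_EFinP; apply: measurable_funM; first exact: measurable_indic.
by apply: measurableT_comp => //; apply: measurable_funM.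
Qed.

End Dilations.

(** * Equivalence of norms in finite dimension *)

Section NormsOnRowVectors.
Context {R : realType} {N : nat}.
Implicit Types (F : 'rV[R]_N -> R) (x y z : 'rV[R]_N).

Lemma ler_coord_supnorm x (i : 'I_N) : `|x ord0 i| <= `|x|.
Proof.
rewrite [leRHS]/Num.norm /= mx_normrE.
exact: (le_bigmax _ (fun ij : 'I_1 * 'I_N => `|x ij.1 ij.2|) (ord0, i)).
Qed.

Lemma is_norm0 F : is_norm F -> F 0 = 0.
Proof. by move=> nF; rewrite -(scale0r 0) (norm_homogeneous nF) normr0 mul0r. Qed.

Lemma is_normN F x : is_norm F -> F (- x) = F x.
Proof. by move=> nF; rewrite -scaleN1r (norm_homogeneous nF) normrN normr1 mul1r. Qed.

Lemma is_norm_gt0 F x : is_norm F -> x != 0 -> 0 < F x.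
Proof.
move=> nF x0; rewrite lt_neqAle (norm_nonneg nF) andbT eq_sym.
by apply: contra x0 => /eqP/(norm_definite nF)/eqP.
Qed.

Lemma is_norm_le_supnorm F : is_norm F -> exists2 C, 0 < C & forall x, F x <= C * `|x|.
Proof.
(* Expansion in the canonical basis gives the sum; the added [1] makes the constant positive even
   when [N = 0]. *)
move=> nF; exists (1 + \sum_(i < N) F (delta_mx ord0 i)) => [|x].
  by rewrite ltr_pwDl // sumr_ge0 // => i _; exact: norm_nonneg.
rewrite {1}(row_sum_delta x) (@le_trans _ _ (\sum_(i < N) F (x ord0 i *: delta_mx ord0 i))) //.
  elim/big_rec2 : _ => [|i a b _ le_ab]; first by rewrite is_norm0.
  by apply: le_trans (norm_triangle nF _ _) _; rewrite lerD2l.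
rewrite mulrDl mul1r ler_wpDl // mulr_suml ler_sum // => i _.
rewrite (norm_homogeneous nF) mulrC ler_wpM2l ?(norm_nonneg nF) //.
exact: ler_coord_supnorm.
Qed.

(** The triangle inequality makes [F] Lipschitz for the sup norm:
    [|F x - F y| <= F (x - y) <= C * |x - y|]. *)
Lemma is_norm_continuous F : is_norm F -> continuous F.
Proof.
move=> nF; have [C C0 FC] := is_norm_le_supnorm _ nF.
move=> x; apply/(@cvgrPdist_le _ _ _ (nbhs x) (nbhs_filter x)) => e e0.
apply/nbhs_ballP; exists (e / C) => /= [|y]; first by rewrite divr_gt0.
rewrite mx_norm_ball /ball_ /= => /ltW xy.
apply: (@le_trans _ _ (F (x - y))).
  have h u w : F u - F w <= F (u - w).
    by rewrite lerBlDr -[u in leLHS](subrK w) norm_triangle.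
  by rewrite ler_norml h andbT lerNl opprB -(is_normN F (x - y) nF) opprB h.
apply: le_trans (FC _) _.
by rewrite mulrC -ler_pdivlMr.
Qed.

(** [F] attains a positive minimum on the compact unit sphere of the sup norm, and homogeneity
    extends the bound to all vectors. *)
Lemma is_norm_ge_supnorm F : is_norm F -> exists2 m, 0 < m & forall x, m * `|x| <= F x.
Proof.
move=> nF; pose S : set 'rV[R]_N := [set x | `|x| = 1].
have xS x : x != 0 -> S (`|x|^-1 *: x).
  by move=> x0; rewrite /S /= normrZ normfV normr_id mulVf // normr_eq0.
(* If the sphere is empty, the only vector is [0] and any positive constant will do. *)
have [S0|S0] := pselect (S !=set0); last first.
  exists 1 => // x; have [->|x0] := eqVneq x 0.
    by rewrite normr0 mulr0 is_norm0.
  by case: S0; exists (`|x|^-1 *: x); exact: xS.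
have cS : compact S.
  apply: bounded_closed_compact.
    exists 1; split => // M M1 x; rewrite /S /= => ->; exact: ltW.
  rewrite /S; apply: (@closed_comp _ _ (fun x : 'rV[R]_N => `|x|) [set 1]).
    by move=> x _; exact: norm_continuous.
  exact: closed_eq.
have [c cinS cmin] := EVT_min_rV S0 cS (continuous_subspaceT (is_norm_continuous _ nF)).
have c0 : c != 0.
  rewrite -normr_eq0; have -> : `|c| = 1 by exact: set_mem cinS.
  exact: oner_neq0.
exists (F c) => [|x]; first exact: is_norm_gt0.
have [->|x0] := eqVneq x 0.
  by rewrite normr0 mulr0 is_norm0.
have := cmin _ (mem_set (xS _ x0)).
rewrite (norm_homogeneous nF) normfV normr_id ler_pdivlMl ?normr_gt0 //.
by rewrite mulrC.
Qed.

End NormsOnRowVectors.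

(** * The dual norm *)

Section DualNorm.
Context {R : realType} {N : nat}.
Variable F : 'rV[R]_N -> R.
Hypothesis nF : is_norm F.
Implicit Types x y z : 'rV[R]_N.

Lemma dotprodC x y : dotprod x y = dotprod y x.
Proof. by apply: eq_bigr => i _; rewrite mulrC. Qed.

Lemma dotprodZl (a : R) x y : dotprod (a *: x) y = a * dotprod x y.
Proof. by rewrite /dotprod mulr_sumr; apply: eq_bigr => i _; rewrite mxE mulrA. Qed.

Lemma dotprodZr (a : R) x y : dotprod x (a *: y) = a * dotprod x y.
Proof. by rewrite dotprodC dotprodZl dotprodC. Qed.

Lemma dotprodDr x y z : dotprod x (y + z) = dotprod x y + dotprod x z.
Proof. by rewrite /dotprod -big_split; apply: eq_bigr => i _; rewrite mxE mulrDr. Qed.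

Lemma dotprod_le_supnorm x y : dotprod x y <= N%:R * `|x| * `|y|.
Proof.
apply: (@le_trans _ _ (\sum_(i < N) `|x| * `|y|)); last first.
  by rewrite sumr_const card_ord -mulrA mulr_natl.
apply: ler_sum => i _; apply: le_trans (ler_norm _) _.
by rewrite normrM ler_pM // ler_coord_supnorm.
Qed.

Let dual_set z := [set dotprod ((F x)^-1 *: x) z | x in [set x | x != 0]].

(** Since [F] dominates [m] times the sup norm, the vectors [x / F x] have sup norm at most [m^-1].
    This bound makes the real-valued [sup] a true supremum when the set is nonempty. *)
Lemma dual_norm_has_ubound z : has_ubound (dual_set z).
Proof.
have [m m0 Fm] := is_norm_ge_supnorm F nF.
exists (N%:R * m^-1 * `|z|) => _ [x /= x0 <-].
apply: le_trans (dotprod_le_supnorm _ _) _.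
rewrite ler_wpM2r // ler_wpM2l // normrZ normfV ger0_norm ?(norm_nonneg nF) //.
by rewrite ler_pdivrMl ?(is_norm_gt0 _ _ nF) // ler_pdivlMr // mulrC.
Qed.

Lemma dotprod_le_dual x z : dotprod x z <= F x * dual_norm F z.
Proof.
have [->|x0] := eqVneq x 0.
  by rewrite (is_norm0 _ nF) mul0r -(scale0r 0) dotprodZl mul0r.
rewrite -ler_pdivrMl ?(is_norm_gt0 _ _ nF) // -dotprodZl.
by apply: ub_le_sup; [exact: dual_norm_has_ubound|exists x].
Qed.

Lemma dual_norm_le z (M : R) : 0 <= M ->
  (forall x, x != 0 -> dotprod x z <= F x * M) -> dual_norm F z <= M.
Proof.
(* Without nonzero vectors the set is empty and [sup] takes its default value [0]; this is where
   [0 <= M] enters. *)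
move=> M0 h; have [E|/set0P E] := eqVneq (dual_set z) set0.
  by rewrite /dual_norm -/(dual_set z) E sup0.
apply: ge_sup => // _ [x /= x0 <-].
by rewrite dotprodZl ler_pdivrMl ?(is_norm_gt0 _ _ nF) // h.
Qed.

(** Test the duality inequality with [z] itself: [0 < <z, z> <= F z * F_* z]. *)
Lemma dual_norm_gt0 z : z != 0 -> 0 < dual_norm F z.
Proof.
move=> z0; rewrite -(pmulr_rgt0 _ (is_norm_gt0 _ _ nF z0)).
apply: lt_le_trans (dotprod_le_dual z z).
rewrite lt_neqAle sumr_ge0 ?andbT => [|i _]; last exact: sqr_ge0.
apply: contra z0; rewrite eq_sym psumr_eq0 => [/allP h|i _]; last exact: sqr_ge0.
apply/eqP/rowP => i; rewrite mxE; apply/eqP.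
by have := h i (mem_index_enum _); rewrite mulf_eq0 orbb.
Qed.

Lemma dual_norm0 : dual_norm F 0 = 0.
Proof.
have d0 x : dotprod x 0 = 0 by rewrite -(scale0r 0) dotprodZr mul0r.
have [E|/set0P E] := eqVneq (dual_set 0) set0.
  by rewrite /dual_norm -/(dual_set 0) E sup0.
rewrite /dual_norm -/(dual_set 0); suff -> : dual_set 0 = [set 0] by rewrite sup1.
apply/seteqP; split => [_ [x _ <-]|_ ->]; first by rewrite d0.
by case: E => y [x x0 _]; exists x; rewrite ?d0.
Qed.

Lemma dual_norm_ge0 z : 0 <= dual_norm F z.
Proof. by have [->|/dual_norm_gt0/ltW//] := eqVneq z 0; rewrite dual_norm0. Qed.

Lemma dual_normZ_le (a : R) z : dual_norm F (a *: z) <= `|a| * dual_norm F z.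
Proof.
apply: dual_norm_le => [|x _]; first by rewrite mulr_ge0 ?dual_norm_ge0.
(* Write [a] as [|a|] times its sign and move the sign onto the test vector, where it does not
   increase [F]. *)
rewrite dotprodZr [a in leLHS]numEsg (mulrC (Num.sg a)) -mulrA -dotprodZl mulrCA.
rewrite ler_wpM2l //; apply: le_trans (dotprod_le_dual _ _) _.
rewrite ler_wpM2r ?dual_norm_ge0 // (norm_homogeneous nF) normr_sg.
by case: (a != 0); rewrite ?mul1r // mul0r (norm_nonneg nF).
Qed.

Lemma dual_norm_is_norm : is_norm (dual_norm F).
Proof.
split.
- exact: dual_norm_ge0.
- by move=> z Hz; apply/eqP; apply: contraTT isT => /dual_norm_gt0; rewrite Hz ltxx.
- move=> a z; apply/eqP; rewrite eq_le dual_normZ_le /=.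
  have [->|a0] := eqVneq a 0; first by rewrite normr0 mul0r dual_norm_ge0.
  (* The reverse inequality is the previous lemma applied to the scalar [a^-1] and the vector
     [a *: z]. *)
  rewrite -ler_pdivlMl ?normr_gt0 // -normfV.
  by apply: le_trans (dual_normZ_le _ _); rewrite scalerA mulVf // scale1r.
- move=> x y; apply: dual_norm_le => [|z _]; first by rewrite addr_ge0 ?dual_norm_ge0.
  by rewrite dotprodDr mulrDr lerD // dotprod_le_dual.
Qed.

End DualNorm.

(** * Borel measurability on row vectors and on tuples *)

(** An open set is a countable union of sup-norm balls with rational centre and radius
    [1 / (k + 1)], and each such ball pulls back to a product of intervals. *)
Lemma measurable_preimage_rV_of_tuple {R : realType} {N : nat} (A : set 'rV[R]_N) :
  open A -> measurable (@rV_of_tuple R N @^-1` A).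
Proof.
move=> oA.
(* The balls are enumerated by [unpickle], with integers that code no ball sent to the empty set;
   [C j] keeps the [j]-th ball only if it lies in [A]. *)
pose B (u : option ('rV[rat]_N * nat)) : set 'rV[R]_N :=
  if u is Some (q, k) then ball (map_mx ratr q : 'rV[R]_N) k.+1%:R^-1 else set0.
pose C j : set 'rV[R]_N := [set x | B (unpickle j) `<=` A /\ B (unpickle j) x].
have -> : A = \bigcup_j C j.
  apply/seteqP; split => [x Ax|x [j _ [/[apply]]] //].
  have /nbhs_ballP[e /= e0 xeA] : nbhs x A by exact: open_nbhs_nbhs.
  (* A ball of radius below [e / 2] that contains [x] is included in [ball x e]. *)
  have [k ke] : exists k : nat, k.+1%:R^-1 < e / 2.
    exists (Num.truncn (2 / e)); rewrite -[ltRHS]invrK ltf_pV2 ?posrE ?invr_gt0 ?divr_gt0 //.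
    by rewrite invf_div truncnS_gt.
  set r : R := k.+1%:R^-1 in ke *.
  have r0 : 0 < r by rewrite invr_gt0.
  have qP (i : 'I_N) : exists q : rat, `|ratr q - x ord0 i| < r.
    have /rat_in_itvoo[q] : x ord0 i - r < x ord0 i + r by lra.
    by rewrite in_itv /= -ltr_distlC => qx; exists q; rewrite distrC.
  have [q {}qP] := choice qP.
  have Bx : ball (map_mx ratr (\row_i q i) : 'rV[R]_N) r x.
    split => // i l; rewrite /ball /= !mxE (ord1 i); exact: qP.
  exists (pickle (\row_i q i : 'rV[rat]_N, k)) => //.
  rewrite /C /= pickleK /=; split => // y qy; apply: xeA.
  rewrite [e]splitr; apply: ball_triangle; last exact: le_ball (ltW ke) _ qy.
  by apply: ball_sym; exact: le_ball (ltW ke) _ Bx.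
rewrite preimage_bigcup; apply: bigcupT_measurable => j.
have [BA|BA] := pselect (B (unpickle j) `<=` A); last first.
  rewrite (_ : _ @^-1` _ = set0) //.
  by apply/seteqP; split => // t [].
rewrite (_ : _ @^-1` _ = rV_of_tuple @^-1` B (unpickle j)); last first.
  by apply/seteqP; split => t => [[]|].
case: unpickle {BA} => [[q k]|]; last by rewrite preimage_set0.
rewrite (_ : _ @^-1` _ = \bigcap_(i : 'I_N)
    ((@tnth N (measurableTypeR R) ^~ i) @^-1` ball (ratr (q ord0 i) : R) k.+1%:R^-1)).
  apply: fin_bigcap_measurable => // i _.
  by rewrite -[X in measurable X]setTI; apply: measurable_tnth => //; exact: measurable_ball.
apply/seteqP; split => t /=.
  by move=> [_ h] i _; have := h ord0 i; rewrite !mxE.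
by move=> h; split => [|i l]; [rewrite invr_gt0|rewrite !mxE (ord1 i); exact: h].
Qed.

Lemma continuous_measurable_rV_of_tuple {R : realType} {N : nat} (f : 'rV[R]_N -> R) :
  continuous f ->
  measurable_fun setT (fun t : N.-tuple (measurableTypeR R) => f (rV_of_tuple t)).
Proof.
move=> /continuousP cf; apply: (measurability _ (RGenOpens.measurableE R)) => //.
move=> _ [_ [a [b ->] <-]]; rewrite setTI.
exact: (measurable_preimage_rV_of_tuple _ (cf _ (interval_open _ _))).
Qed.

(** * Calculus for functions supported away from the origin *)

Lemma diff_dotprod_grad {R : realType} {N : nat} (f : 'rV[R]_N -> R) (x y : 'rV[R]_N) :
  differentiable f x -> 'd f x y = dotprod (grad f x) y.
Proof.
move=> df; rewrite [y in LHS]row_sum_delta linear_sum; apply: eq_bigr => i _.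
have -> : grad f x ord0 i = 'd f x (delta_mx ord0 i) by rewrite mxE deriveE.
rewrite (linearZ_LR ('d f x)).
by rewrite mulrC.
Qed.

Section PuncturedC1.
Context {R : realType} {N : nat}.
Variable v : 'rV[R]_N -> R.
Hypothesis hv : C1_0_punctured v.

Lemma vanish_off_support x : ~ support_of v x -> v x = 0.
Proof.
by move=> nx; apply: contra_notP nx => /eqP vx; exact: subset_closure.
Qed.

(** The complement of the support is open, so near [x] the function coincides with the constant
    [0]. *)
Lemma grad_off_support x : ~ support_of v x -> grad v x = 0.
Proof.
move=> nx; apply/rowP => i; rewrite !mxE.
have oS : open (~` support_of v) by rewrite openC; exact: closed_closure.
have -> : 'D_(delta_mx ord0 i) v x = 'D_(delta_mx ord0 i) (cst (0 : R)) x.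
  apply: near_eq_derive.
  near=> y; rewrite /cst vanish_off_support //.
  by near: y; exact: (open_nbhs_nbhs (conj oS nx)).
exact: derive_cst.
Unshelve. all: by end_near. Qed.

Lemma near0_off_support : \forall x \near (0 : 'rV[R]_N), ~ support_of v x.
Proof.
have oS : open (~` support_of v) by rewrite openC; exact: closed_closure.
apply: open_nbhs_nbhs; split => //.
by have [_ _ sub0] := hv; move=> /sub0; apply.
Qed.

(** The [C^1] hypothesis is silent at the origin; continuity holds there because [v] is constant
    nearby. The same argument serves for the gradient below. *)
Lemma punctured_C1_continuous : continuous v.
Proof.
have [[dv _] _ _] := hv; move=> x.
have [->|/eqP x0] := eqVneq x 0; last exact: (differentiable_continuous (dv _ x0)).
have h : \forall y \near (0 : 'rV[R]_N), v y = v 0.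
  near=> y; rewrite !vanish_off_support //; first exact: nbhs_singleton near0_off_support.
  by near: y; exact: near0_off_support.
exact: (@cvg_near_cst _ _ _ _ _ (nbhs_filter (0 : 'rV[R]_N)) h).
Unshelve. all: by end_near. Qed.

Lemma punctured_C1_grad_continuous : continuous (grad v).
Proof.
have [[_ cv] _ _] := hv; move=> x.
have [->|/eqP x0] := eqVneq x 0; last exact: cv.
have h : \forall y \near (0 : 'rV[R]_N), grad v y = grad v 0.
  near=> y; rewrite !grad_off_support //; first exact: nbhs_singleton near0_off_support.
  by near: y; exact: near0_off_support.
exact: (@cvg_near_cst _ _ _ _ _ (nbhs_filter (0 : 'rV[R]_N)) h).
Unshelve. all: by end_near. Qed.

Lemma punctured_C1_bounded_support :
  exists2 M, 0 < M & forall x, M < `|x| -> v x = 0.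
Proof.
have [_ /compact_bounded [M [_ bM]] _] := hv.
exists (`|M| + 1) => [|x Mx]; first by rewrite ltr_pwDr.
apply: vanish_off_support => Sx.
have : `|x| <= `|M| + 1.
  by apply: bM Sx; rewrite (le_lt_trans (ler_norm M)) // ltrDl.
by rewrite leNgt Mx.
Qed.

(** Chain rule: [e^s x] is its own derivative in [s], and it never meets the origin. *)
Lemma is_derive_along_ray x t : x != 0 ->
  is_derive t (1 : R) (fun s => v (expR s *: x))
    (dotprod (grad v (expR t *: x)) (expR t *: x)).
Proof.
move=> x0; pose g (s : R) := expR s *: x.
have y0 : g t != 0 by rewrite scaler_eq0 negb_or x0 gt_eqF ?expR_gt0.
have [[dv _] _ _] := hv.
have dvy : differentiable v (g t) by apply: dv; exact/eqP.
have de : differentiable (@expR R) t by exact/derivable1_diffP.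
have dg : differentiable g t.
  exact: differentiableZl.
have gE : 'd g t 1 = g t.
  by rewrite /g diffZl //= -deriveE // derive_val.
have dphi : differentiable (v \o g) t by exact: differentiable_comp.
apply: DeriveDef; first exact/derivable1_diffP.
rewrite deriveE // diff_comp //= gE.
exact: diff_dotprod_grad.
Qed.

End PuncturedC1.

(** * The inequality along rays and the gradient bound *)

Lemma rV_of_scale_tuple {R : realType} {N : nat} (a : R) (t : N.-tuple (measurableTypeR R)) :
  rV_of_tuple (scale_tuple a t) = a *: rV_of_tuple t.
Proof. by apply/rowP => i; rewrite !mxE tnth_map. Qed.

Lemma measurable_powR_norm {d} {T : measurableType d} {R : realType} (f : T -> R) (p : R) :
  measurable_fun setT f -> measurable_fun setT (fun t => `|f t| `^ p).
Proof.
move=> mf; apply: (measurableT_comp (measurable_powR p)).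
exact: measurableT_comp.
Qed.

Section HardyAlongRays.
Context {R : realType} {N : nat}.
Variables (F v : 'rV[R]_N -> R).
Hypotheses (nF : is_norm F) (hv : C1_0_punctured v).

Let H := dual_norm F.
Let D y := dotprod (grad v y) y.

Lemma dotprod_grad_continuous : continuous (fun y => dotprod (grad v y) y).
Proof.
have cg := punctured_C1_grad_continuous _ hv.
rewrite /dotprod; apply: (continuous_big (x0 := 0)) => [|i _]; first exact: add_continuous.
have ci : continuous (fun z : 'rV[R]_N => z ord0 i) by exact: coord_continuous.
have cgi : continuous ((fun z : 'rV[R]_N => z ord0 i) \o grad v).
  by move=> y; apply: continuous_comp; [exact: cg|exact: ci].
by move=> y; apply: continuousM; [exact: cgi|exact: ci].
Qed.

(** The half-line inequality is applied to [t |-> v (e^t x)] and multiplied by [H x ^ alpha]. By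
    homogeneity this weight is [e^(-alpha t) * H (e^t x) ^ alpha], which accounts for the shift by
    [alpha] in the exponent. *)
Lemma hardy_along_ray (c p alpha : R) x : 0 < c -> 1 < p ->
  ((c `^ (p - 1) * (`|v x| `^ p * H x `^ alpha))%:E <=
   \int[lebesgue_measure]_(t in `[0%R, +oo[)
     ((expR ((c * (p - 1) - alpha) * t))%:E *
      (`|D (expR t *: x)| `^ p * H (expR t *: x) `^ alpha)%:E))%E.
Proof.
move=> c0 p1; have [->|x0] := eqVneq x 0.
  have -> : v 0 = 0.
    apply: (vanish_off_support v); exact: nbhs_singleton (near0_off_support _ hv).
  rewrite normr0 powR0 ?mul0r ?mulr0; last by rewrite gt_eqF //; lra.
  apply: integral_ge0 => t _.
  by rewrite -EFinM lee_fin !mulr_ge0 ?expR_ge0 ?powR_ge0.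
have [M M0 vM] := punctured_C1_bounded_support _ hv.
(* Since [e^T >= 1 + T > T], the point [e^T x] has norm larger than [M] and so lies outside the
   support. *)
pose T := M / `|x|.
have T0 : 0 < T by rewrite divr_gt0 ?normr_gt0.
have phiT : v (expR T *: x) = 0.
  apply: vM; rewrite normrZ ger0_norm ?expR_ge0 // -ltr_pdivrMr ?normr_gt0 //.
  by apply: lt_le_trans (expR_ge1Dx T); rewrite -/T ltrDr.
have cdphi : continuous (fun t : R => D (expR t *: x)).
  move=> t; apply: (@continuous_comp _ _ _ (fun t : R => expR t *: x) D).
    by apply: cvgZr_tmp; exact: continuous_expR.
  exact: dotprod_grad_continuous.
have Hx := dual_norm_gt0 F nF x x0.
have := hardy_halfline R _ _ c p T c0 p1 T0
  (fun t => is_derive_along_ray v hv x t x0) cdphi phiT.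
rewrite expR0 scale1r => h.
rewrite mulrA mulrC EFinM.
have Hx0 : (0 <= (H x `^ alpha)%:E)%E by rewrite lee_fin powR_ge0.
apply: le_trans (lee_wpmul2l Hx0 h) _.
rewrite -ge0_integralZl //; last first.
  apply/measurable_EFinP; apply: measurable_funTS; apply: measurable_funM.
    by apply: measurable_powR_norm; exact: continuous_measurable_fun.
  by apply: measurableT_comp => //; apply: measurable_funM.
rewrite le_eqVlt; apply/orP; left; apply/eqP; apply: eq_integral => t _.
rewrite -!EFinM; congr EFin.
rewrite /H (norm_homogeneous (dual_norm_is_norm _ nF)) (ger0_norm (expR_ge0 t)).
rewrite (powRM _ (expR_ge0 t) (ltW Hx)) -expRM.
have -> : expR (c * (p - 1) * t) = expR ((c * (p - 1) - alpha) * t) * expR (t * alpha).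
  by rewrite -expRD; congr expR; ring.
by rewrite /D; ring.
Qed.

Lemma grad_dual_norm_bound (p gamma : R) y : 1 < p ->
  `|D y| `^ p * H y `^ (gamma - p) <= F (grad v y) `^ p * H y `^ gamma.
Proof.
move=> p1; have p0 : p != 0 by rewrite gt_eqF //; lra.
(* At the origin the left side is [0], whatever value [powR] gives to a power of [0]. *)
have [->|y0] := eqVneq y 0.
  rewrite /D -[X in dotprod _ X](scale0r 0) dotprodZr mul0r normr0 powR0 // mul0r.
  by rewrite mulr_ge0 ?powR_ge0.
have Hy : 0 < H y := dual_norm_gt0 F nF y y0.
have -> : H y `^ gamma = H y `^ p * H y `^ (gamma - p).
  by rewrite -powRD ?subrKC // (gt_eqF Hy) implybT.
rewrite mulrA ler_wpM2r ?powR_ge0 // -powRM ?(norm_nonneg nF) ?(ltW Hy) //.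
apply: ge0_ler_powR; rewrite ?nnegrE ?mulr_ge0 ?(norm_nonneg nF) ?(ltW Hy) //; first lra.
(* The lower bound is the duality inequality for the opposite gradient, as [F] is even. *)
rewrite ler_norml dotprod_le_dual // andbT lerNl -mulN1r -dotprodZl.
apply: le_trans (dotprod_le_dual _ nF _ _) _.
by rewrite scaleN1r (is_normN _ _ nF).
Qed.

End HardyAlongRays.

(** * Assembly of the weighted inequality *)

Theorem theorem5p4 (R : realType) (N : nat) (F : 'rV[R]_N -> R) (p gamma : R)
    (hF : C1_strictly_convex_norm F)
    (hp : 1 < p < N%:R) (hgamma : p - N%:R < gamma)
    (v : 'rV[R]_N -> R) (hv : C1_0_punctured v) :
  ((((N%:R + gamma - p) / p) `^ p)%:E *
     integralRN (fun x => (`|v x| `^ p * dual_norm F x `^ (gamma - p))%:E)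
   <= integralRN (fun x => (F (grad v x) `^ p * dual_norm F x `^ gamma)%:E))%E.
Proof.
have [nF _ _] := hF; have /andP[p1 _] := hp.
set c := (N%:R + gamma - p) / p.
have p0 : 0 < p by lra.
have c0 : 0 < c by rewrite divr_gt0 //; lra.
(* This is the exponent in [hardy_along_ray] for [alpha = gamma - p]. As [c * p = N + gamma - p],
   the Jacobian [e^(-Nt)] turns [e^(bt)] into [e^(-ct)]. *)
pose b := c * (p - 1) - (gamma - p).
have bNc : b - N%:R = - c by rewrite /b /c; field; lra.
pose H := dual_norm F.
(* A negative power is discontinuous at [0], so the continuous [H] is composed with a merely
   measurable power. *)
have mH (a : R) : measurable_fun setT
    (fun t : N.-tuple (measurableTypeR R) => H (rV_of_tuple t) `^ a).
  apply: (measurableT_comp (measurable_powR a)).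
  apply: continuous_measurable_rV_of_tuple.
  exact: is_norm_continuous (dual_norm_is_norm _ nF).
have mcomp (f : 'rV[R]_N -> R) (a : R) : continuous f -> measurable_fun setT
    (fun t : N.-tuple (measurableTypeR R) => `|f (rV_of_tuple t)| `^ a).
  by move=> cf; apply: measurable_powR_norm; exact: continuous_measurable_rV_of_tuple.
pose W (t : N.-tuple (measurableTypeR R)) : \bar R :=
  (`|dotprod (grad v (rV_of_tuple t)) (rV_of_tuple t)| `^ p *
   H (rV_of_tuple t) `^ (gamma - p))%:E.
have mW : measurable_fun setT W.
  apply/measurable_EFinP; apply: measurable_funM => //.
  by apply: (mcomp (fun y => dotprod (grad v y) y)); exact: dotprod_grad_continuous.
have W0 t : (0 <= W t)%E by rewrite lee_fin mulr_ge0 ?powR_ge0.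
have mv : measurable_fun setT (fun t : N.-tuple (measurableTypeR R) =>
    (`|v (rV_of_tuple t)| `^ p * H (rV_of_tuple t) `^ (gamma - p))%:E).
  apply/measurable_EFinP; apply: measurable_funM => //.
  by apply: mcomp; exact: punctured_C1_continuous.
have v0 t : (0 <= (`|v (rV_of_tuple t)| `^ p * H (rV_of_tuple t) `^ (gamma - p))%:E)%E.
  by rewrite lee_fin mulr_ge0 ?powR_ge0.
have rays : ((c `^ (p - 1))%:E *
    integralRN (fun x => (`|v x| `^ p * H x `^ (gamma - p))%:E) <=
    (c^-1)%:E * \int[lebesgueN R N]_t W t)%E.
  rewrite -(ge0_integral_dilations b W mW W0 c c0 bNc) /integralRN.
  rewrite -ge0_integralZl ?lee_fin ?powR_ge0 //.
  apply: ge0_le_integral => //.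
  - by move=> t _; rewrite mule_ge0 // lee_fin powR_ge0.
  - exact: measurable_funeM.
  - exact: measurable_integral_dilations.
  move=> t _; rewrite -EFinM.
  apply: le_trans (hardy_along_ray F v nF hv c p (gamma - p) _ c0 p1) _.
  by under [leRHS]eq_integral do rewrite /W rV_of_scale_tuple.
have WF : (\int[lebesgueN R N]_t W t <=
    integralRN (fun x => (F (grad v x) `^ p * H x `^ gamma)%:E))%E.
  apply: ge0_le_integral => //.
  - apply/measurable_EFinP; apply: measurable_funM => //.
    apply: (measurableT_comp (measurable_powR p)).
    apply: (continuous_measurable_rV_of_tuple (F \o grad v)) => y.
    apply: continuous_comp; first exact: punctured_C1_grad_continuous.
    exact: is_norm_continuous.
  - by move=> t _; rewrite lee_fin; exact: grad_dual_norm_bound.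
apply: le_trans WF.
(* The ray inequality carries [c ^ (p - 1)]; the remaining factor [c] cancels the [c^-1] from the
   integration over dilations. *)
have cp : c `^ p = c * c `^ (p - 1).
  by rewrite -{2}(powRr1 (ltW c0)) -powRD ?subrKC // (gt_eqF c0) implybT.
rewrite cp EFinM -muleA.
apply: (@le_trans _ _ (c%:E * ((c^-1)%:E * \int[lebesgueN R N]_t W t))%E).
  by apply: lee_wpmul2l => //; rewrite lee_fin ltW.
by rewrite muleA -EFinM divff ?gt_eqF // mul1e.
Qed.
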